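(* Let $f$ and $n$ be positive integers. (1) If $f=1$, then for each integer $k \in \{2, 3, \ldots, n-4\}$ there exists a finite, simple, undirected, connected graph $G$ such that $|V(G)| = n$, $\dim(G) = k$ and $\mathrm{bf}(G) = f = 1$. (2) If $f>1$, then for each integer $k \in \{f, f+1, \ldots, \lfloor n-\frac{3}{2}f-1 \rfloor\}$ there exists a finite, simple, undirected, connected graph $G$ such that $|V(G)| = n$, $\dim(G) = k$ and $\mathrm{bf}(G) = f$. (The ranges of $k$ are understood to be empty when the upper endpoint is smaller than the lower one.)
   Context: For vertices $u,v$ of a connected graph $G$, $d_G(u,v)$ is the number of edges in a shortest $u$–$v$ path. A vertex $x$ resolves two vertices $u,v$ if $d_G(u,x)\neq d_G(v,x)$. A set $R\subseteq V(G)$ is a resolving set of $G$ if every pair of distinct vertices of $G$ is resolved by some vertex of $R$. A metric basis of $G$ is a resolving set of smallest possible cardinality, and this cardinality is the metric dimension $\dim(G)$. A basis forced vertex of $G$ is a vertex that belongs to every metric basis of $G$; $\mathrm{bf}(G)$ denotes the number of basis forced vertices of $G$. *)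

(* Defs.v *)
From HB Require Import structures.
From mathcomp Require Import all_boot all_order all_algebra.

Set Implicit Arguments.
Unset Strict Implicit.
Unset Printing Implicit Defensive.

Record sgraph := SGraph {
  vertex :> finType;
  adj : rel vertex;
  adj_sym : symmetric adj;
  adj_irrefl : irreflexive adj }.

Section MetricDimension.
Variable G : sgraph.
Implicit Types (u v x : G) (R B : {set G}).

Definition connected : bool := [forall u, forall v, connect (@adj G) u v].

Definition is_path u v (p : seq G) : bool :=
  [&& path (@adj G) u p, last u p == v & uniq (u :: p)].

(* A path u :: p has size p edges, and fewer than #|G| because its vertices are
   distinct; so this is the least length of a path from u to v, or the junk
   value #|G| when there is none. *)
Definition dist u v : nat :=
  find (fun m => [exists p : m.-tuple G, is_path u v p]) (iota 0 #|G|).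

Definition resolves x u v : bool := dist u x != dist v x.

Definition resolving R : bool :=
  [forall u, forall v, (u != v) ==> [exists x in R, resolves x u v]].

Definition metric_basis B : bool :=
  resolving B && [forall R, resolving R ==> (#|B| <= #|R|)].

Definition metric_dim : nat :=
  #|[arg min_(R < [set: G] | resolving R) #|R| ]|.

Definition basis_forced x : bool := [forall B, metric_basis B ==> (x \in B)].

Definition bf : nat := #|[set x | basis_forced x]|.

Lemma is_path_size u v p : is_path u v p -> size p < #|G|.
Proof.
by case/and3P=> _ _ up; rewrite -[(size p).+1]/(size (u :: p)) -(card_uniqP up) max_card.
Qed.

Lemma dist_le u v p : is_path u v p -> dist u v <= size p.
Proof.
move=> hp; rewrite leqNgt; apply/negP => lt.
have := before_find 0 lt; rewrite nth_iota ?(is_path_size hp) // add0n.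
by move/existsP; apply; exists (in_tuple p).
Qed.

Lemma dist_path u v :
  connected -> exists2 p, is_path u v p & size p = dist u v.
Proof.
move=> /forallP/(_ u)/forallP/(_ v)/connectP[q pq ->].
case/shortenP: pq => p pp up _.
have hp : is_path u (last u p) p by rewrite /is_path pp eqxx.
have hs : has (fun m => [exists r : m.-tuple G, is_path u (last u p) r]) (iota 0 #|G|).
  apply/hasP; exists (size p); first by rewrite mem_iota (is_path_size hp).
  by apply/existsP; exists (in_tuple p).
have := nth_find 0 hs; rewrite nth_iota ?add0n; last first.
  by rewrite -[X in _ < X](size_iota 0) -has_find.
by case/existsP=> r hr; exists r => //; rewrite size_tuple.
Qed.

Lemma distxx u : dist u u = 0.
Proof.
by apply/eqP; rewrite -leqn0 (@dist_le u u [::]) // /is_path /= eqxx.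
Qed.

Lemma dist_eq0 u v : dist u v = 0 -> u = v.
Proof.
rewrite /dist; have : 0 < #|G| by apply/card_gt0P; exists u.
case: #|G| => // m _ /=; case: ifP => // /existsP[p].
by rewrite tuple0 => /and3P[_ /eqP].
Qed.

(* So the minimum in metric_dim is over a nonempty family. *)
Lemma resolving_setT : resolving [set: G].
Proof.
apply/forallP=> u; apply/forallP=> v; apply/implyP=> uv.
apply/existsP; exists u; rewrite inE /resolves distxx eq_sym /=.
by apply: contra uv => /eqP/dist_eq0->.
Qed.

Lemma metric_basis_card B : metric_basis B = resolving B && (#|B| == metric_dim).
Proof.
rewrite /metric_basis /metric_dim; case: arg_minnP => [|A rA minA].
  exact: resolving_setT.
case rB: (resolving B) => //=; rewrite eqn_leq minA // andbT.
apply/forallP/idP => [/(_ A)|le R]; first by rewrite rA.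
by apply/implyP=> rR; apply: leq_trans le (minA _ rR).
Qed.

End MetricDimension.

(* Main.v *)
(* Call a set R of vertices of a graph K locating-dominating if the vertices
   outside R have pairwise distinct, nonempty neighbourhoods in R.  Take the
   complement of K, join it to a clique on m >= 1 vertices, and hang a path at a
   vertex w of K.  Apart from the path all distances are at most 2, so a vertex
   of K only sees adjacency in K; the clique vertices are twins, at distance 1
   from all of K, so that all but one of them must be chosen and the remaining
   one forces every vertex of K to be dominated in K.  If every locating set of K
   has at least g elements and w lies in no locating-dominating set of size g,
   then the metric bases are exactly the unions of a locating-dominating set of
   size g and m - 1 clique vertices.  The clique thus raises the dimension and
   the path only the order.  Forced vertices add up over disjoint unions of such
   graphs K, so it is enough to have graphs on 5, 5 and 8 vertices with 1, 2 and
   3 forced vertices. *)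
Require Import Defs.
From mathcomp Require Import all_boot all_order all_algebra.
From mathcomp Require Import zify lra.
Import Order.TTheory GRing.Theory Num.Theory.

Set Implicit Arguments.
Unset Strict Implicit.
Unset Printing Implicit Defensive.

(** * Graphs with a prescribed distance function *)

Section GraphOfDistance.
Variables (V : finType) (d : V -> V -> nat).
Hypothesis d_eq0 : forall x y, (d x y == 0) = (x == y).
Hypothesis dC : forall x y, d x y = d y x.
(** Moving along an edge lowers [d] to a fixed target by at most one, and by [d_step] some edge
    attains this drop; so [d] is the path distance of its own distance-1 relation. *)
Hypothesis d_lip : forall x z y, d x z = 1 -> d x y <= (d z y).+1.
Hypothesis d_step : forall x y, x != y -> exists2 z, d x z = 1 & d x y = (d z y).+1.

Definition dist1 : rel V := fun x y => d x y == 1.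

Lemma dist1_sym : symmetric dist1.
Proof. by move=> x y; rewrite /dist1 dC. Qed.

Lemma dist1_irrefl : irreflexive dist1.
Proof. by move=> x; have := d_eq0 x x; rewrite eqxx /dist1 => /eqP->. Qed.

Definition dist_graph := SGraph dist1_sym dist1_irrefl.

Lemma path_size_ge (u v : dist_graph) p :
  path (@adj dist_graph) u p -> last u p = v -> d u v <= size p.
Proof.
elim: p u => [|z p IH] u /=.
  by move=> _ ->; rewrite leqn0 d_eq0.
case/andP=> /eqP uz pz ev; apply: leq_trans (d_lip _ uz) _.
exact: IH.
Qed.

Lemma geodesic (u v : dist_graph) :
  exists2 p, is_path u v p & size p <= d u v.
Proof.
have [p pp [lp sp]] : exists2 p, path (@adj dist_graph) u p & last u p = v /\ size p = d u v.
  have [k] := ubnP (d u v); elim: k u => // k IH u lt.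
  have [->|uv] := eqVneq u v.
    by exists [::] => //; split=> //; apply/esym/eqP; rewrite d_eq0.
  have [z uz e] := d_step uv.
  have [|p pp [lp sp]] := IH z; first by rewrite -ltnS -e.
  exists (z :: p); last by rewrite /= sp e.
  by rewrite /= pp andbT; apply/eqP.
(* [is_path] demands distinct vertices; removing the loops does not lengthen the walk. *)
rewrite -sp -{}lp; case: (shortenP pp) => q pq uq sq.
exists q; first by rewrite /is_path pq eqxx uq.
have := uniq_leq_size _ sq; apply.
by case/andP: uq.
Qed.

Lemma dist_graph_connected : connected dist_graph.
Proof.
apply/forallP=> u; apply/forallP=> v; have [p /and3P[pp /eqP lp _] _] := geodesic u v.
by apply/connectP; exists p.
Qed.

Lemma dist_graphE (u v : dist_graph) : dist u v = d u v.
Proof.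
apply/eqP; rewrite eqn_leq; apply/andP; split.
  by have [p /dist_le hp] := geodesic u v; apply: leq_trans.
have [p /and3P[pp /eqP lp _] <-] := dist_path u v dist_graph_connected.
exact: path_size_ge.
Qed.

Lemma dist_graph_resolvingP (R : {set dist_graph}) :
  reflect (forall u v : V, u != v -> exists2 r : V, r \in R & d u r != d v r)
          (resolving R).
Proof.
apply: (iffP forallP) => [res u v uv|res u].
  have /forallP/(_ v)/implyP/(_ uv)/existsP[r /andP[rR]] := res u.
  by rewrite /resolves !dist_graphE; exists r.
apply/forallP=> v; apply/implyP=> /res[r rR ne].
by apply/existsP; exists r; rewrite rR /resolves !dist_graphE.
Qed.

End GraphOfDistance.

Lemma card_set_sum (A B : finType) (R : {set A + B}) :
  #|R| = #|inl @^-1: R| + #|inr @^-1: R|.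
Proof.
rewrite -!sum1_card big_sumType /=.
by congr (_ + _); apply: eq_bigl => x; rewrite inE.
Qed.

(** * Locating-dominating sets and their forced vertices *)

Section LocatingDominating.
Variables (T : finType) (e : rel T).
Implicit Types (R : {set T}) (g : nat).

Definition locating R :=
  [forall x, forall y,
    [|| x == y, x \in R, y \in R | [exists r, (r \in R) && (e x r != e y r)]]].

Definition dominating R :=
  [forall x, (x \in R) || [exists r, (r \in R) && e x r]].

Definition ld_set g R := [&& locating R, dominating R & #|R| == g].

Definition ld_forced g := [set x | [forall R, ld_set g R ==> (x \in R)]].

(** The lower bound concerns sets that merely locate, because a resolving set containing the whole
    clique yields no domination. The vertex [w] is the future foot of the path. *)
Definition ld_system g w :=
  [/\ symmetric e, irreflexive e, (forall R, locating R -> g <= #|R|),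
      (exists R, ld_set g R) & (forall R, ld_set g R -> w \notin R)].

Lemma locatingP R :
  reflect (forall x y, x != y -> x \notin R -> y \notin R ->
             exists2 r, r \in R & e x r != e y r)
          (locating R).
Proof.
apply: (iffP forallP) => [h x y xy xR yR|h x].
  have /forallP/(_ y) := h x; rewrite (negPf xy) (negPf xR) (negPf yR) /=.
  by case/existsP=> r /andP[]; exists r.
apply/forallP=> y; case: eqVneq => //= xy.
case: (boolP (x \in R)) => //= xR; case: (boolP (y \in R)) => //= yR.
by have [r rR ne] := h x y xy xR yR; apply/existsP; exists r; rewrite rR.
Qed.

Lemma dominatingP R :
  reflect (forall x, x \notin R -> exists2 r, r \in R & e x r) (dominating R).
Proof.
apply: (iffP forallP) => [h x xR|h x].
  have := h x; rewrite (negPf xR) /=.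
  by case/existsP=> r /andP[]; exists r.
case: (boolP (x \in R)) => //= /h[r rR ne].
by apply/existsP; exists r; rewrite rR.
Qed.

Lemma ld_forcedP g x :
  reflect (forall R, ld_set g R -> x \in R) (x \in ld_forced g).
Proof.
rewrite inE; apply: (iffP forallP) => h R; first by apply/implyP/h.
exact/implyP/h.
Qed.

End LocatingDominating.

(** * Additivity over disjoint unions *)

Section DisjointUnion.
Variables (T1 T2 : finType) (e1 : rel T1) (e2 : rel T2).

Definition union_rel : rel (T1 + T2) := fun u v =>
  match u, v with
  | inl x, inl y => e1 x y
  | inr x, inr y => e2 x y
  | _, _ => false
  end.

Definition union_set (R1 : {set T1}) (R2 : {set T2}) : {set T1 + T2} :=
  [set u | match u with inl x => x \in R1 | inr x => x \in R2 end].

Lemma union_setl R1 R2 : inl @^-1: union_set R1 R2 = R1.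
Proof. by apply/setP=> x; rewrite !inE. Qed.

Lemma union_setr R1 R2 : inr @^-1: union_set R1 R2 = R2.
Proof. by apply/setP=> x; rewrite !inE. Qed.

Lemma card_union_set R1 R2 : #|union_set R1 R2| = #|R1| + #|R2|.
Proof. by rewrite card_set_sum union_setl union_setr. Qed.

Lemma locating_union (R : {set T1 + T2}) :
  locating union_rel R -> locating e1 (inl @^-1: R) && locating e2 (inr @^-1: R).
Proof.
move/locatingP=> h; apply/andP; split; apply/locatingP=> x y xy; rewrite !inE => xR yR.
  by have [|[r|r] rR //= ne] := h (inl x) (inl y) _ xR yR => //; exists r; rewrite ?inE.
by have [|[r|r] rR //= ne] := h (inr x) (inr y) _ xR yR => //; exists r; rewrite ?inE.
Qed.

Lemma dominating_union (R : {set T1 + T2}) :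
  dominating union_rel R = dominating e1 (inl @^-1: R) && dominating e2 (inr @^-1: R).
Proof.
apply/dominatingP/andP=> [h|[/dominatingP h1 /dominatingP h2]].
  split; apply/dominatingP=> x; rewrite !inE => xR.
    by have [[r|r] rR //= ne] := h (inl x) xR; exists r; rewrite ?inE.
  by have [[r|r] rR //= ne] := h (inr x) xR; exists r; rewrite ?inE.
case=> x xR.
  by have [|r] := h1 x; rewrite !inE => // rR ne; exists (inl r).
by have [|r] := h2 x; rewrite !inE => // rR ne; exists (inr r).
Qed.

(** Vertices of different summands are separated by a chosen neighbour of one of them, which
    domination provides. *)
Lemma locating_union_dom (R : {set T1 + T2}) :
  locating e1 (inl @^-1: R) -> locating e2 (inr @^-1: R) ->
  dominating union_rel R -> locating union_rel R.
Proof.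
move=> /locatingP h1 /locatingP h2 /dominatingP dom; apply/locatingP.
move=> [x|x] [y|y] xy xR yR.
- by have [||| r] := h1 x y; rewrite ?inE // => rR; exists (inl r).
- by have [[r|r] rR //= xr] := dom _ xR; exists (inl r); rewrite //= xr.
- by have [[r|r] rR //= xr] := dom _ xR; exists (inr r); rewrite //= xr.
- by have [||| r] := h2 x y; rewrite ?inE // => rR; exists (inr r).
Qed.

Variables (g1 g2 : nat) (w1 : T1) (w2 : T2).
Hypotheses (S1 : ld_system e1 g1 w1) (S2 : ld_system e2 g2 w2).

(** Both parts locate, so they have at least [g1] and [g2] elements; a total of [g1 + g2] makes both
    bounds equalities. *)
Lemma ld_set_union (R : {set T1 + T2}) :
  ld_set union_rel (g1 + g2) R =
  ld_set e1 g1 (inl @^-1: R) && ld_set e2 g2 (inr @^-1: R).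
Proof.
have [_ _ min1 _ _] := S1; have [_ _ min2 _ _] := S2.
apply/idP/idP => [/and3P[/locating_union/andP[l1 l2]]|].
  rewrite dominating_union => /andP[dm1 dm2]; rewrite card_set_sum => /eqP c.
  rewrite /ld_set l1 l2 dm1 dm2 /=; move: (min1 _ l1) (min2 _ l2) c.
  move: #|_| #|_| => a b; lia.
case/andP=> /and3P[l1 dm1 /eqP c1] /and3P[l2 dm2 /eqP c2].
have dm : dominating union_rel R by rewrite dominating_union dm1.
by rewrite /ld_set dm locating_union_dom //= card_set_sum c1 c2.
Qed.

Lemma ld_system_union : ld_system union_rel (g1 + g2) (inl w1).
Proof.
have [sym1 irr1 min1 [B1 hB1] no1] := S1; have [sym2 irr2 min2 [B2 hB2] no2] := S2.
split.
- by move=> [x|x] [y|y] /=.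
- by move=> [x|x] /=.
- move=> R /locating_union/andP[/min1 l1 /min2 l2].
  by rewrite card_set_sum leq_add.
- by exists (union_set B1 B2); rewrite ld_set_union union_setl union_setr hB1.
- by move=> R; rewrite ld_set_union => /andP[/no1]; rewrite inE.
Qed.

Lemma ld_forced_union :
  ld_forced union_rel (g1 + g2) = union_set (ld_forced e1 g1) (ld_forced e2 g2).
Proof.
have [_ _ _ [B1 hB1] _] := S1; have [_ _ _ [B2 hB2] _] := S2.
apply/setP=> -[x|x]; rewrite [RHS]inE; apply/ld_forcedP/ld_forcedP=> h R hR.
(* A minimum set of one summand is completed by a fixed minimum set of the other. *)
- have := h (union_set R B2); rewrite ld_set_union union_setl union_setr hR hB2.
  by rewrite inE; apply.
- by move: hR; rewrite ld_set_union => /andP[/h]; rewrite inE.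
- have := h (union_set B1 R); rewrite ld_set_union union_setl union_setr hR hB1.
  by rewrite inE; apply.
- by move: hR; rewrite ld_set_union => /andP[_ /h]; rewrite inE.
Qed.

End DisjointUnion.

(** * Exhaustive verification on small graphs, with subsets encoded as bit sequences *)

Section FiniteCheck.
Variables (n : nat) (E : seq (nat * nat)).

Definition edge_nat (i j : nat) := ((i, j) \in E) || ((j, i) \in E).
Definition edge_rel : rel 'I_n := fun i j => edge_nat i j.

(* Conditionals stand for || and && because [vm_compute] is call-by-value. *)
Definition locating_bits (s : bitseq) :=
  all (fun x => all (fun y =>
    if [|| x == y, nth false s x | nth false s y] then true else
    has (fun r => if nth false s r then edge_nat x r != edge_nat y r else false)
      (iota 0 n)) (iota 0 n)) (iota 0 n).

Definition dominating_bits (s : bitseq) :=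
  all (fun x => if nth false s x then true else
    has (fun r => if nth false s r then edge_nat x r else false) (iota 0 n))
  (iota 0 n).

Definition bits_of (R : {set 'I_n}) : bitseq := [seq i \in R | i <- enum 'I_n].

Definition set_of_bits (s : bitseq) : {set 'I_n} := [set i : 'I_n | nth false s i].

Fixpoint all_bits k : seq bitseq :=
  if k is k'.+1 then map (cons true) (all_bits k') ++ map (cons false) (all_bits k')
  else [:: [::]].

Lemma mem_all_bits s : s \in all_bits (size s).
Proof.
by elim: s => //= -[] s IH; rewrite mem_cat !map_f // orbT.
Qed.

Lemma all_iotaE (P : pred nat) : all P (iota 0 n) = [forall i : 'I_n, P i].
Proof.
apply/allP/forallP=> [h i|h i]; first by apply: h; rewrite mem_iota /=.
by rewrite mem_iota /= => lt; apply: (h (Ordinal lt)).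
Qed.

Lemma has_iotaE (P : pred nat) : has P (iota 0 n) = [exists i : 'I_n, P i].
Proof.
apply/hasP/existsP=> [[i]|[i Pi]]; last by exists (val i); rewrite ?mem_iota /=.
by rewrite mem_iota /= => lt Pi; exists (Ordinal lt).
Qed.

Lemma nth_bits R (i : 'I_n) : nth false (bits_of R) i = (i \in R).
Proof. by rewrite (nth_map i) ?nth_ord_enum // size_enum_ord. Qed.

Lemma count_bits R : count id (bits_of R) = #|R|.
Proof. by rewrite count_map cardE size_filter enumT; apply: eq_count. Qed.

Lemma bits_in_all R : bits_of R \in all_bits n.
Proof. by have := mem_all_bits (bits_of R); rewrite size_map size_enum_ord. Qed.

Lemma locating_bitsE R : locating edge_rel R = locating_bits (bits_of R).
Proof.
rewrite /locating_bits all_iotaE; apply: eq_forallb => x.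
rewrite all_iotaE; apply: eq_forallb => y.
rewrite has_iotaE !nth_bits val_eqE; case: (x == y) (x \in R) (y \in R) => [] [] [] //=.
by apply: eq_existsb => r; rewrite nth_bits; case: (r \in R).
Qed.

Lemma dominating_bitsE R : dominating edge_rel R = dominating_bits (bits_of R).
Proof.
rewrite /dominating_bits all_iotaE; apply: eq_forallb => x.
rewrite has_iotaE nth_bits; case: (x \in R) => //=.
by apply: eq_existsb => r; rewrite nth_bits; case: (r \in R).
Qed.

Definition ld_sets_bits g :=
  [seq s <- all_bits n |
    if count id s == g then locating_bits s && dominating_bits s else false].

Lemma ld_set_bitsE g R : ld_set edge_rel g R = (bits_of R \in ld_sets_bits g).
Proof.
rewrite mem_filter bits_in_all andbT /ld_set locating_bitsE dominating_bitsE count_bits.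
by case: (#|R| == g); rewrite ?andbT ?andbF.
Qed.

Lemma size_all_bits k s : s \in all_bits k -> size s = k.
Proof.
elim: k s => [|k IH] s /=; first by rewrite inE => /eqP->.
by rewrite mem_cat => /orP[] /mapP[t /IH <- ->].
Qed.

Lemma set_of_bitsK s : size s = n -> bits_of (set_of_bits s) = s.
Proof.
move=> sz; apply: (@eq_from_nth _ false) => [|i].
  by rewrite size_map size_enum_ord.
rewrite size_map size_enum_ord => lt.
by rewrite (nth_bits (set_of_bits s) (Ordinal lt)) inE.
Qed.

Lemma ld_set_of_bits g s : s \in ld_sets_bits g -> ld_set edge_rel g (set_of_bits s).
Proof.
move=> hs; rewrite ld_set_bitsE set_of_bitsK //.
by move: hs; rewrite mem_filter => /andP[_ /size_all_bits].
Qed.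

(** Every premise is a closed computation once the graph is given; [l] is the evaluated list of
    minimum sets, from which existence and the avoidance of [w] are read off. *)
Lemma ld_system_bits g (w : 'I_n) l :
  all (fun i => ~~ edge_nat i i) (iota 0 n) ->
  all (fun s => if g <= count id s then true else ~~ locating_bits s) (all_bits n) ->
  ld_sets_bits g = l ->
  l != [::] -> all (fun s => ~~ nth false s w) l ->
  ld_system edge_rel g w.
Proof.
rewrite all_iotaE => /forallP irr /allP min el ne /allP no; split.
- by move=> x y; rewrite /edge_rel /edge_nat orbC.
- by move=> x; apply/negbTE/irr.
- move=> R; rewrite locating_bitsE => h; have := min _ (bits_in_all R).
  by rewrite count_bits h; case: (g <= #|R|).
- case: l el ne {no} => // s l el _.
  by exists (set_of_bits s); apply: ld_set_of_bits; rewrite el mem_head.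
- by move=> R; rewrite ld_set_bitsE el => /no; rewrite nth_bits.
Qed.

Lemma card_ld_forced_bits g l :
  ld_sets_bits g = l ->
  #|ld_forced edge_rel g| =
  count (fun i => all (fun s => nth false s i) l) (iota 0 n).
Proof.
move=> <-; rewrite -val_enum_ord count_map cardE size_filter enumT.
apply: eq_count => i /=; apply/ld_forcedP/allP => [h s /ld_set_of_bits/h|h R].
  by rewrite inE.
by rewrite ld_set_bitsE => /h; rewrite nth_bits.
Qed.

End FiniteCheck.

(* [edges_f] is used to obtain [f] forced vertices: the complement of the tree
   {01, 02, 03, 14}, the path 0-1-2-3-4, and the tree with a leaf 3 and two legs
   5-1-4 and 7-2-6 attached to 0. *)
Definition edges_1 := [:: (0, 4); (1, 2); (1, 3); (2, 3); (2, 4); (3, 4)].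
Definition edges_2 := [:: (0, 1); (1, 2); (2, 3); (3, 4)].
Definition edges_3 := [:: (0, 3); (0, 5); (0, 7); (1, 4); (1, 5); (2, 6); (2, 7)].

(** * The three small systems and their unions *)

Lemma ld_sets_1 : ld_sets_bits 5 edges_1 2 =
  [:: [:: false; false; true; false; true]; [:: false; false; false; true; true]].
Proof. by vm_compute. Qed.

Lemma ld_sets_2 : ld_sets_bits 5 edges_2 2 = [:: [:: false; true; false; true; false]].
Proof. by vm_compute. Qed.

Lemma ld_sets_3 : ld_sets_bits 8 edges_3 3 =
  [:: [:: true; true; true; false; false; false; false; false]].
Proof. by vm_compute. Qed.

Lemma ld_system_1 : ld_system (@edge_rel 5 edges_1) 2 ord0.
Proof. by apply: ld_system_bits ld_sets_1 _ _; vm_compute. Qed.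

Lemma ld_system_2 : ld_system (@edge_rel 5 edges_2) 2 ord0.
Proof. by apply: ld_system_bits ld_sets_2 _ _; vm_compute. Qed.

Lemma ld_system_3 : ld_system (@edge_rel 8 edges_3) 3 ord_max.
Proof. by apply: ld_system_bits ld_sets_3 _ _; vm_compute. Qed.

(** Adding a path on 5 vertices raises both [f] and the minimum size by 2, so the cases 2 and 3
    generate all larger ones. Only for [f = 1] does the minimum size, 2, exceed [f]. *)
Lemma ld_system_exists f : 0 < f ->
  exists (T : finType) (e : rel T) (w : T),
    [/\ ld_system e (maxn 2 f) w,
        #|T| = (if f == 1 then 5 else uphalf (5 * f))
      & #|ld_forced e (maxn 2 f)| = f].
Proof.
elim/ltn_ind: f => -[|[|[|[|f]]]] // IH _.
- exists 'I_5, (@edge_rel 5 edges_1), ord0; split; rewrite ?card_ord //.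
    exact: ld_system_1.
  by rewrite (card_ld_forced_bits ld_sets_1).
- exists 'I_5, (@edge_rel 5 edges_2), ord0; split; rewrite ?card_ord //.
    exact: ld_system_2.
  by rewrite (card_ld_forced_bits ld_sets_2).
- exists 'I_8, (@edge_rel 8 edges_3), ord_max; split; rewrite ?card_ord //.
    exact: ld_system_3.
  by rewrite (card_ld_forced_bits ld_sets_3).
have [//||T [e [w [S cT cF]]]] := IH f.+2; first by [].
rewrite (_ : maxn 2 f.+2 = f.+2) in S cF; last by lia.
have -> : maxn 2 f.+4 = f.+2 + 2 by lia.
exists (T + 'I_5)%type, (union_rel e (@edge_rel 5 edges_2)), (inl w); split.
- exact: ld_system_union S ld_system_2.
- by rewrite card_sum cT card_ord /=; lia.
rewrite (ld_forced_union S ld_system_2) card_union_set cF.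
by rewrite (card_ld_forced_bits ld_sets_2) addn2.
Qed.

(** * The complement joined to a clique, with a pendant path, and its distances *)

Section Construction.
Variables (T : finType) (e : rel T) (g m L : nat) (w : T).
Hypothesis sys : ld_system e g w.
Hypothesis m_gt0 : 0 < m.

(* Left to right: the clique, the vertices of the graph [e], the path, whose
   vertex 0 is the neighbour of [w]. *)
Definition padded_vertex : finType := ('I_m + T + 'I_L)%type.

(** Non-neighbours in [e] are adjacent in the complement; neighbours in [e] are at distance 2,
    through a clique vertex. *)
Definition co_dist (x y : T) : nat := if x == y then 0 else (e x y).+1.

(** Path vertex [j] is [j.+1] away from [w], through which every route off the path runs. The last
    clause is an absolute difference, as subtraction is truncated. *)
Definition padded_dist (u v : padded_vertex) : nat :=
  match u, v with
  | inl (inl i), inl (inl j) => i != j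
  | inl (inl _), inl (inr _) | inl (inr _), inl (inl _) => 1
  | inl (inl _), inr j | inr j, inl (inl _) => j.+2
  | inl (inr x), inl (inr y) => co_dist x y
  | inl (inr x), inr j | inr j, inl (inr x) => j.+1 + co_dist x w
  | inr i, inr j => (i - j) + (j - i)
  end.

Let e_sym : symmetric e. Proof. by case: sys. Qed.
Let e_irr : irreflexive e. Proof. by case: sys. Qed.

Lemma co_distC x y : co_dist x y = co_dist y x.
Proof. by rewrite /co_dist eq_sym e_sym. Qed.

Lemma co_dist_le2 x y : co_dist x y <= 2.
Proof. by rewrite /co_dist; case: eqP; case: (e x y). Qed.

Lemma co_dist_eq0 x y : (co_dist x y == 0) = (x == y).
Proof. by rewrite /co_dist; case: (x == y). Qed.

Lemma co_dist_ne x y r : r != x -> r != y -> co_dist x r != co_dist y r -> e x r != e y r.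
Proof.
rewrite /co_dist ![_ == r]eq_sym => /negPf-> /negPf->.
by rewrite eqSS; case: (e x r); case: (e y r).
Qed.

Lemma co_dist_lip x z y : co_dist x z = 1 -> co_dist x y <= (co_dist z y).+1.
Proof.
move=> xz; case: (eqVneq z y) => [<-|zy]; first by rewrite xz.
have := co_dist_le2 x y; have := co_dist_eq0 z y; rewrite (negPf zy).
by move: (co_dist z y) (co_dist x y); lia.
Qed.

Lemma padded_dist_eq0 u v : (padded_dist u v == 0) = (u == v).
Proof.
case: u v => [[i|x]|i] [[j|y]|j] //=.
- by rewrite eqb0 negbK.
- exact: co_dist_eq0.
- by rewrite -[inr i == inr j]/(i == j) -val_eqE /=; lia.
Qed.

Lemma padded_distC u v : padded_dist u v = padded_dist v u.
Proof.
case: u v => [[i|x]|i] [[j|y]|j] //=.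
- by rewrite eq_sym.
- exact: co_distC.
- by rewrite addnC.
Qed.

Lemma path_end (j : nat) x : j.+1 + co_dist x w = 1 -> j = 0 /\ x = w.
Proof.
rewrite addSn => -[] /eqP; rewrite addn_eq0 => /andP[/eqP-> ].
by rewrite co_dist_eq0 => /eqP->.
Qed.

Lemma padded_dist_lip u z v : padded_dist u z = 1 -> padded_dist u v <= (padded_dist z v).+1.
Proof.
case: u z v => [[i|x]|i] [[j|y]|j] [[k|z]|k] //=.
- by case: (i != k).
- by case: (i != k).
- by lia.
- by have := co_dist_le2 x z; lia.
- by have := co_dist_le2 x w; lia.
- by move/co_dist_lip=> /(_ z).
- by move/co_dist_lip=> /(_ w); rewrite -addnS leq_add2l.
- by move/path_end=> [-> ->]; rewrite co_distC; lia.
- by move/path_end=> [-> ->]; rewrite /co_dist eqxx; lia.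
- by move/path_end=> [-> _].
- by move/path_end=> [-> ->]; rewrite co_distC; lia.
- by move/path_end=> [-> ->]; lia.
- by lia.
- by lia.
- by lia.
Qed.

Lemma padded_dist_step u v :
  u != v -> exists2 z, padded_dist u z = 1 & padded_dist u v = (padded_dist z v).+1.
Proof.
move=> uv; have [d1|d1] := eqVneq (padded_dist u v) 1.
  exists v => //; rewrite d1; congr _.+1; apply/esym/eqP; by rewrite padded_dist_eq0.
have d2 : 1 < padded_dist u v by have := padded_dist_eq0 u v; rewrite (negPf uv); lia.
(* [c] is the midpoint between core vertices at distance 2; [b], the vertex [w], is the gate to the
   path. *)
pose c : padded_vertex := inl (inl (Ordinal m_gt0)); pose b : padded_vertex := inl (inr w).
have bw : co_dist w w = 0 by rewrite /co_dist eqxx.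
move: d2 {d1 uv}; case: u v => [[i|x]|i] [[j|y]|j] //= d2.
- by case: (i != j) d2.
- by exists b => //=; rewrite bw addn0.
- by exists c => //=; have := co_dist_le2 x y; lia.
- have := co_dist_le2 x w; case dx: (co_dist x w) => [|[|[|k]]] // _.
  + have L_gt0 : 0 < L by apply: leq_ltn_trans (ltn_ord j).
    by exists (inr (Ordinal L_gt0)); rewrite /= ?dx; lia.
  + by exists b; rewrite //= bw; lia.
  + by exists c; rewrite //= ; lia.
- case: i d2 => -[|i] lt _.
    by exists b; rewrite /= ?bw.
  by exists (inr (Ordinal (ltnW lt))); rewrite /=; lia.
- case: i d2 => -[|i] lt _.
    by exists b; rewrite /= ?bw // co_distC.
  by exists (inr (Ordinal (ltnW lt))); rewrite /=; lia.
- have [lt|le] := ltnP i j.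
    by exists (inr (Ordinal (leq_ltn_trans lt (ltn_ord j)))); rewrite /=; lia.
  case: i d2 le => -[|i] lt d2 le; first by move: d2 le => /=; lia.
  by exists (inr (Ordinal (ltnW lt))); move: d2 le; rewrite /=; lia.
Qed.

Definition padded_graph := dist_graph padded_dist_eq0 padded_distC.

Lemma padded_graph_connected : connected padded_graph.
Proof. exact: (dist_graph_connected padded_dist_eq0 padded_distC padded_dist_step). Qed.

Lemma card_padded_graph : #|padded_graph| = m + #|T| + L.
Proof. by rewrite !card_sum !card_ord. Qed.

Lemma padded_graph_resolvingP (R : {set padded_graph}) :
  reflect (forall u v : padded_vertex, u != v ->
             exists2 r : padded_vertex, r \in R & padded_dist u r != padded_dist v r)
          (resolving R).
Proof. exact: (dist_graph_resolvingP padded_dist_lip padded_dist_step). Qed.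

(** * Lower bound for resolving sets *)

Definition clique_part (R : {set padded_vertex}) : {set 'I_m} := inl @^-1: (inl @^-1: R).
Definition core_part (R : {set padded_vertex}) : {set T} := inr @^-1: (inl @^-1: R).
Definition path_part (R : {set padded_vertex}) : {set 'I_L} := inr @^-1: R.

Implicit Types R : {set padded_vertex}.

Lemma card_parts R : #|R| = #|clique_part R| + #|core_part R| + #|path_part R|.
Proof. by rewrite !card_set_sum. Qed.

(** Distances from a path vertex to the clique and the core are those from [w] plus a constant, so
    all chosen path vertices can be replaced by [w]. *)
Definition trace (R : {set padded_vertex}) : {set T} :=
  if path_part R == set0 then core_part R else w |: core_part R.

Lemma card_trace R : #|trace R| <= #|core_part R| + (path_part R != set0).
Proof.
rewrite /trace; case: eqP => _; first by rewrite addn0.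
by rewrite cardsU1 addnC leq_add2l leq_b1.
Qed.

Lemma trace_T R x : inl (inr x) \in R -> x \in trace R.
Proof. by move=> h; rewrite /trace; case: ifP; rewrite !inE h ?orbT. Qed.

Lemma trace_P R j : inr j \in R -> w \in trace R.
Proof.
move=> h; rewrite /trace ifF ?inE ?eqxx //.
by apply/negbTE/set0Pn; exists j; rewrite inE.
Qed.

Lemma trace_notin R x r : x \notin trace R -> inl (inr r) \in R -> r != x.
Proof. by move=> xR /trace_T rR; apply: contraNneq xR => <-. Qed.

Lemma locating_trace (R : {set padded_graph}) : resolving R -> locating e (trace R).
Proof.
move=> /padded_graph_resolvingP res; apply/locatingP=> x y xy xR yR.
have [|[[i|r]|j] rR /=] := res (inl (inr x)) (inl (inr y)); first by [].
- by [].
- by exists r; [exact: trace_T | apply: co_dist_ne; rewrite ?(trace_notin _ rR)].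
have wR := trace_P rR; rewrite eqn_add2l => ne; exists w => //.
by apply: co_dist_ne ne; [apply: contraNneq xR | apply: contraNneq yR] => <-.
Qed.

(** The omitted clique vertex [i] is at distance 1 from the other clique vertices and from the core,
    so what resolves it from [x] comes, after passing to the trace, from a vertex at distance 2 from
    [x], a neighbour of [x] in [e]. *)
Lemma dominating_trace (R : {set padded_graph}) i :
  resolving R -> i \notin clique_part R -> dominating e (trace R).
Proof.
move=> /padded_graph_resolvingP res iR; apply/dominatingP=> x xR.
have far r : r != x -> 1 != co_dist x r -> e x r.
  by rewrite eq_sym /co_dist => /negPf->; case: (e x r).
have [|[[j|r]|j] rR /=] := res (inl (inl i)) (inl (inr x)); first by [].
- by case: (eqVneq i j) iR => // ->; rewrite !inE rR.
- by exists r; [exact: trace_T | apply: far; rewrite ?(trace_notin _ rR)].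
have wR := trace_P rR; rewrite -[j.+2]addn1 eqn_add2l => ne.
by exists w => //; apply: far => //; apply: contraNneq xR => <-.
Qed.

Lemma clique_part_ge (R : {set padded_graph}) : resolving R -> m.-1 <= #|clique_part R|.
Proof.
move=> /padded_graph_resolvingP res; have := cardsC (clique_part R); rewrite card_ord.
suff : #|~: clique_part R| <= 1 by move: #|_| #|_| => *; lia.
rewrite leqNgt; apply/negP => /card_gt1P[i [j [iR jR ij]]].
have [|[[k|r]|k] rR /=] := res (inl (inl i)) (inl (inl j)); rewrite ?eqxx //.
have out l : l \in ~: clique_part R -> l != k.
  by apply: contraTneq => ->; rewrite !inE rR.
by rewrite !out.
Qed.

Lemma path_part_gt0 R : (path_part R != set0) <= #|path_part R|.
Proof. by rewrite -card_gt0; case: #|_|. Qed.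

(* A set containing all of ['I_m] leaves one vertex of [T] possibly undominated,
   but it has one vertex more; a set meeting the path is traced to a
   locating-dominating set containing [w], which is not minimum. *)
Lemma resolving_ge (R : {set padded_graph}) : resolving R ->
  g + m.-1 <= #|R| /\ (#|R| = g + m.-1 -> ld_set e g (core_part R)).
Proof.
move=> res; have [_ _ min _ no] := sys.
have loc := locating_trace res; have gle := min _ loc.
have Cge := clique_part_ge res; have tle := card_trace R; have Ple := path_part_gt0 R.
rewrite card_parts.
have [full|] := boolP [forall i, i \in clique_part R].
  have : #|clique_part R| = m.
    by rewrite -[RHS]card_ord; apply: eq_card => i; rewrite (forallP full).
  by move: #|_| #|_| #|_| #|_| gle tle Ple m_gt0 => *; lia.
case/forallPn=> i iR; have dom := dominating_trace res iR.
have [P0|P0] := eqVneq (path_part R) set0.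
  move: loc dom gle; rewrite /trace P0 eqxx cards0 => loc dom gle.
  split; first by lia.
  by move=> c; rewrite /ld_set loc dom /=; apply/eqP; lia.
have wR : w \in trace R by case/set0Pn: P0 => j; rewrite inE => /trace_P.
have neq : #|trace R| != g.
  by apply/negP => c; have := no (trace R); rewrite /ld_set loc dom c wR => /(_ isT).
by rewrite P0 in tle Ple; lia.
Qed.

(** * Metric bases, dimension and forced vertices *)

Definition basis_of (B : {set T}) (i : 'I_m) : {set padded_graph} :=
  [set u : padded_vertex | match u with
     inl (inl j) => j != i | inl (inr x) => x \in B | inr _ => false end].

Lemma basis_of_resolving B i : ld_set e g B -> resolving (basis_of B i).
Proof.
case/and3P=> /locatingP loc /dominatingP dom /eqP cB.
apply/padded_graph_resolvingP.
have wB : w \notin B.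
  by have [_ _ _ _] := sys; apply; apply/and3P;
    split; [apply/locatingP | apply/dominatingP | apply/eqP].
have far x r : e x r -> co_dist x r = 2.
  by rewrite /co_dist; case: eqP => [->|_ ->]; rewrite ?e_irr.
(* Path vertex [k] is at distance [k + 3] from [r0], all clique and core vertices at distance at
   most 2; so [r0] resolves every pair that meets the path. *)
have [r0 r0B er0] := dom _ wB.
have fw : co_dist r0 w = 2 by rewrite co_distC far.
pose sep (u v : padded_vertex) :=
  exists2 r : padded_vertex, r \in basis_of B i & padded_dist u r != padded_dist v r.
have bin x : x \in B -> (inl (inr x) : padded_vertex) \in basis_of B i by rewrite inE.
have sep_sym u v : sep u v -> sep v u by case=> r rB ne; exists r; rewrite // eq_sym.
have sep_self (u v : padded_vertex) : u != v -> u \in basis_of B i -> sep u v.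
  move=> uv uR; exists u => //; have /eqP-> : padded_dist u u == 0 by rewrite padded_dist_eq0.
  by rewrite eq_sym padded_dist_eq0 eq_sym.
have sep_clique_core j y : y \notin B -> sep (inl (inl j)) (inl (inr y)).
  by move=> /dom[r rB /far yr]; exists (inl (inr r)); [exact: bin | rewrite /= yr].
have sep_clique_path j k : sep (inl (inl j)) (inr k).
  by exists (inl (inr r0)); [exact: bin | rewrite /= fw; lia].
have sep_core_path x k : sep (inl (inr x)) (inr k).
  by exists (inl (inr r0)); [exact: bin | rewrite /= fw; have := co_dist_le2 x r0; lia].
move=> u v uv; change (sep u v).
have [uR|uR] := boolP (u \in basis_of B i); first exact: sep_self.
have [vR|vR] := boolP (v \in basis_of B i).
  by apply: sep_sym; apply: sep_self; rewrite // eq_sym.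
case: u v uv uR vR => [[j|x]|j] [[k|y]|k] uv; rewrite !inE ?negbK => uR vR.
- by rewrite (eqP uR) (eqP vR) eqxx in uv.
- exact: sep_clique_core.
- exact: sep_clique_path.
- exact/sep_sym/sep_clique_core.
- have [r rB exy] := loc x y uv uR vR; exists (inl (inr r)); first exact: bin.
  have ne z : z \notin B -> (z == r) = false by apply: contraNF => /eqP->.
  by rewrite /= /co_dist !ne // eqSS; case: (e x r) (e y r) exy => [] [].
- exact: sep_core_path.
- exact/sep_sym/sep_clique_path.
- exact/sep_sym/sep_core_path.
- by exists (inl (inr r0)); [exact: bin | rewrite /= fw; apply: contraNneq uv => h;
    apply/eqP; congr inr; apply: val_inj => /=; lia].
Qed.

Lemma card_basis_of B i : ld_set e g B -> #|basis_of B i| = g + m.-1.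
Proof.
case/and3P=> _ _ /eqP cB; rewrite card_parts.
have -> : clique_part (basis_of B i) = ~: [set i] by apply/setP=> j; rewrite !inE.
have -> : core_part (basis_of B i) = B by apply/setP=> x; rewrite !inE.
have -> : path_part (basis_of B i) = set0 by apply/setP=> x; rewrite !inE.
by rewrite cards0 cardsC1 card_ord cB addn0 addnC.
Qed.

Lemma metric_dim_padded_graph : metric_dim padded_graph = g + m.-1.
Proof.
have [_ _ _ [B hB] _] := sys; have i := Ordinal m_gt0.
rewrite /metric_dim; case: arg_minnP => [|R res min]; first exact: resolving_setT.
apply/eqP; rewrite eqn_leq (resolving_ge res).1 andbT -(card_basis_of i hB).
exact/min/basis_of_resolving.
Qed.

Lemma basis_of_metric_basis B i : ld_set e g B -> metric_basis (basis_of B i).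
Proof.
move=> hB; rewrite metric_basis_card metric_dim_padded_graph basis_of_resolving //=.
exact/eqP/card_basis_of.
Qed.

(** Each clique vertex is omitted by some [basis_of], and no [basis_of] meets the path. So forced
    vertices lie in the core, where the metric bases cut out exactly the minimum locating-dominating
    sets. *)
Lemma bf_padded_graph : bf padded_graph = #|ld_forced e g|.
Proof.
have [_ _ _ [B hB] _] := sys; pose i := Ordinal m_gt0.
have inj : injective (fun x : T => inl (inr x) : padded_graph) by move=> x y [].
rewrite /bf -(card_imset _ inj); apply: eq_card => u; rewrite inE.
apply/forallP/imsetP => [forced|[x /ld_forcedP hx ->] R].
  have in_basis B' i' : ld_set e g B' -> u \in basis_of B' i'.
    by move=> hB'; have /implyP := forced (basis_of B' i'); apply; apply: basis_of_metric_basis.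
  case: u in_basis {forced} => [[j|x]|j] in_basis.
  - by have := in_basis B j hB; rewrite inE eqxx.
  - exists x => //; apply/ld_forcedP=> B' hB'.
    by have := in_basis B' i hB'; rewrite inE.
  - by have := in_basis B i hB; rewrite inE.
apply/implyP; rewrite metric_basis_card metric_dim_padded_graph => /andP[res /eqP c].
by have := hx _ ((resolving_ge res).2 c); rewrite !inE.
Qed.

End Construction.

(** * Choice of the parameters *)

Lemma graph_exists f k n : 0 < f -> maxn 2 f <= k ->
  k + (if f == 1 then 4 else uphalf (3 * f) + 1) <= n ->
  exists G : sgraph, [/\ connected G, #|G| = n, metric_dim G = k & bf G = f].
Proof.
move=> f_gt0 fk kn; have [T [e [w [S cT cF]]]] := ld_system_exists f_gt0.
(* This clique size solves [g + m.-1 = k] for [g = maxn 2 f]; the path takes up the remaining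
   vertices. *)
have m_gt0 : 0 < k.+1 - maxn 2 f by lia.
pose L := n - (k.+1 - maxn 2 f) - #|T|.
exists (padded_graph L S m_gt0); split.
- exact: padded_graph_connected.
- rewrite card_padded_graph /L; move: cT kn; case: eqP => _ -> kn; lia.
- rewrite metric_dim_padded_graph; lia.
- by rewrite bf_padded_graph.
Qed.

Theorem theorem12 (f n : nat) (hf : 0 < f) (hn : 0 < n) :
  (f = 1 -> forall k : nat, 2 <= k <= n - 4 ->
     exists G : sgraph,
       [/\ connected G, #|G| = n, metric_dim G = k & bf G = f]) /\
  (1 < f -> forall k : nat,
     f <= k ->
     (k%:Z <= Num.floor (n%:Q - 3%:Q / 2%:Q * f%:Q - 1))%R ->
     exists G : sgraph,
       [/\ connected G, #|G| = n, metric_dim G = k & bf G = f]).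
Proof.
split=> [-> k /andP[k2 kn]|f1 k fk kn].
  (* The bounds [2 <= k <= n - 4] force [n >= 6], so this subtraction is not truncated. *)
  by apply: graph_exists; rewrite //= ; lia.
apply: graph_exists; [by [] | by lia | ].
rewrite ifF; last by lia.
(* The rational bound doubled; integrality turns [3f/2] into [uphalf (3 * f)]. *)
suff : k * 2 + 3 * f + 2 <= n * 2 by lia.
move: kn; rewrite Num.Theory.floor_ge_int -(ler_nat rat) !natrD !natrM => kn.
have : (k%:R <= n%:R - 3 / 2 * f%:R - 1 :> rat)%R by [].
lra.
Qed.
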